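(* Let $G$ be an additive abelian group of order $v$ and let $D_1,D_2$ be two sets of size $\frac{v-1}{2}$ which partition $G\setminus\{0\}$. Then $\{D_1,D_2\}$ is a strong external difference family in $G$ (for some $\lambda$) if and only if $D_1$ is a Paley-type partial difference set in $G$; moreover, in that case $D_2$ is also a Paley-type partial difference set in $G$.
   Context: A $k$-element subset $D$ of an additive group $G$ of order $v$ is a $(v,k,\lambda,\mu)$ partial difference set (PDS) if the multiset $\{d_1-d_2 : d_1,d_2\in D,\ d_1\neq d_2\}$ contains each non-identity element of $D$ exactly $\lambda$ times and each non-identity element of $G\setminus D$ exactly $\mu$ times. A PDS $D$ is regular if $0\notin D$ and $D=-D$. A regular PDS with parameters $\left(v,\frac{v-1}{2},\frac{v-5}{4},\frac{v-1}{4}\right)$, where $v\equiv 1\pmod 4$, is said to be of Paley type. For disjoint subsets $A,B$ of an additive abelian group $G$, let $\mathcal{D}(A,B)$ denote the multiset $\{x-y : x\in A,\ y\in B\}$. An $(n,m,k,\lambda)$-strong external difference family (SEDF) in an additive abelian group $G$ of order $n$ is a set of $m\geq 2$ pairwise disjoint $k$-subsets $A_1,\dots,A_m$ of $G$ such that for every $i$, the multiset union $\bigcup_{j\neq i}\mathcal{D}(A_i,A_j)$ contains every nonzero element of $G$ exactly $\lambda$ times. *)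

(* Defs.v *)
From HB Require Import structures.
From mathcomp Require Import all_boot all_order all_algebra.
Set Implicit Arguments.
Unset Strict Implicit.
Unset Printing Implicit Defensive.
Import GRing.Theory.
Local Open Scope ring_scope.

(* Multiplicity of g in the multiset {x - y : x in A, y in B}. *)
Definition diff_mult (G : finZmodType) (A B : {set G}) (g : G) : nat :=
  #|[set p : G * G | [&& p.1 \in A, p.2 \in B & p.1 - p.2 == g]]|.

(* Multiplicity of g in the multiset {x - y : x, y in D, x <> y}. *)
Definition self_diff_mult (G : finZmodType) (D : {set G}) (g : G) : nat :=
  #|[set p : G * G |
      [&& p.1 \in D, p.2 \in D, p.1 != p.2 & p.1 - p.2 == g]]|.

Definition is_PDS (G : finZmodType) (v k lambda mu : nat) (D : {set G}) : Prop :=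
  [/\ #|G| = v, #|D| = k,
      forall g : G, g != 0 -> g \in D -> self_diff_mult D g = lambda
    & forall g : G, g != 0 -> g \notin D -> self_diff_mult D g = mu].

Definition is_regular_PDS (G : finZmodType) (v k lambda mu : nat)
    (D : {set G}) : Prop :=
  [/\ is_PDS v k lambda mu D, 0 \notin D & D = [set - x | x in D]].

(* When v = 1 [mod 4] all the quotients are exact. The subtraction v - 5 is
   truncated only for v = 1; D is then empty, so lambda is unconstrained. *)
Definition is_Paley_PDS (G : finZmodType) (v : nat) (D : {set G}) : Prop :=
  v = 1 %[mod 4] /\
  is_regular_PDS v ((v - 1) %/ 2) ((v - 5) %/ 4) ((v - 1) %/ 4) D.

(* The blocks are listed as A_1, ..., A_m; disjointness makes them pairwise
   distinct as soon as k > 0. *)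
Definition is_SEDF (G : finZmodType) (n m k lambda : nat)
    (A : m.-tuple {set G}) : Prop :=
  [/\ #|G| = n, (2 <= m)%N,
      forall i : 'I_m, #|tnth A i| = k,
      forall i j : 'I_m, i != j -> [disjoint tnth A i & tnth A j]
    & forall (i : 'I_m) (g : G), g != 0 ->
        (\sum_(j < m | j != i) diff_mult (tnth A i) (tnth A j) g)%N = lambda].

(* Main.v *)
Require Import Defs.
From HB Require Import structures.
From mathcomp Require Import all_boot all_order all_algebra.
From mathcomp Require Import zify.
Set Implicit Arguments.
Unset Strict Implicit.
Unset Printing Implicit Defensive.
Import GRing.Theory.
Local Open Scope ring_scope.

(** Write [N A B g] for the multiplicity of [g] among the differences [x - y]
    with [x] in [A] and [y] in [B]. If [D1], [D2] and [{0}] partition [G], then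
    for [g != 0] each [x] in [D1] has [x - g] in exactly one of the three parts,
    so [N D1 D1 g + N D1 D2 g + (g \in D1) = #|D1|]. Hence [N D1 D2] is constant
    off [0] iff [N D1 D1] takes two values differing by one on and off [D1].
    Since [N D1 D1 (- g) = N D1 D1 g], constancy also forces [D1 = - D1], and counting all
    pairs gives [k ^ 2 = 2 k lambda], that is [v = 4 lambda + 1]. *)

Lemma diff_multE (G : finZmodType) (A B : {set G}) (g : G) :
  diff_mult A B g = #|[set x in A | x - g \in B]|.
Proof.
have inj_pair : injective (fun x : G => (x, x - g)) by move=> x y [].
rewrite /diff_mult -(card_imset _ inj_pair).
congr #|pred_of_set _|; apply/setP => -[x y]; rewrite inE /=.
apply/and3P/imsetP => [[xA yB /eqP <-]|[z]].
  by exists x; rewrite ?inE ?subKr ?xA.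
by rewrite inE => /andP[zA zgB] [-> ->]; split; rewrite ?subKr.
Qed.

Lemma diff_multN (G : finZmodType) (A B : {set G}) (g : G) :
  diff_mult A B (- g) = diff_mult B A g.
Proof.
have inj_swap : injective (fun p : G * G => (p.2, p.1)).
  by move=> [x y] [z t] [-> ->].
rewrite /diff_mult -(card_imset _ inj_swap).
congr #|pred_of_set _|; apply/setP => -[y x]; rewrite inE /=.
apply/imsetP/and3P => [[[z t]]|[yB xA /eqP <-]].
  by rewrite inE /= => /and3P[zA tB /eqP e] [-> ->]; rewrite -opprB e opprK.
by exists (x, y); rewrite // inE xA yB opprB eqxx.
Qed.

Lemma self_diff_multE (G : finZmodType) (D : {set G}) (g : G) :
  g != 0 -> self_diff_mult D g = diff_mult D D g.
Proof.
move=> g0; rewrite /self_diff_mult /diff_mult.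
congr #|pred_of_set _|; apply/setP => -[x y]; rewrite !inE /=.
case: (x - y =P g) => [e|]; last by rewrite !andbF.
by rewrite -subr_eq0 e g0.
Qed.

Lemma sum_diff_mult (G : finZmodType) (A B : {set G}) :
  (\sum_g diff_mult A B g = #|A| * #|B|)%N.
Proof.
rewrite -cardsX -sum1_card (partition_big (fun p => p.1 - p.2) predT) //=.
apply: eq_bigr => g _; rewrite /diff_mult -sum1_card.
by apply: eq_bigl => -[x y]; rewrite !inE /= andbA.
Qed.

Section Partition.

Variables (G : finZmodType) (A B : {set G}).
Hypothesis (AB_disj : [disjoint A & B]) (AB_cover : A :|: B = [set~ 0]).

Lemma mem_blockC (x : G) : (x \in B) = (x != 0) && (x \notin A).
Proof.
have : (x \in A :|: B) = (x != 0) by rewrite AB_cover !inE.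
rewrite inE => <-; case: (boolP (x \in A)) => /= xA; last by rewrite andbT.
exact: disjointFr AB_disj xA.
Qed.

Lemma card_block_partition : (#|A| + #|B| = #|G|.-1)%N.
Proof. by rewrite -cardsUI (disjoint_setI0 AB_disj) cards0 addn0 AB_cover cardsC1. Qed.

Lemma zero_notin_block : 0 \notin A.
Proof. by have := in_setC1 0 (0 : G); rewrite -AB_cover inE eqxx; case: (0 \in A). Qed.

Lemma diff_mult_partition (g : G) :
  (diff_mult A A g + diff_mult A B g + (g \in A) = #|A|)%N.
Proof.
(* The indicator is recast as a count over [x] in [A], met only by [x = g], so that the three terms
   can be added pointwise in [x]. *)
have -> : (g \in A : nat) = #|[set x in A | x - g == 0]|.
  rewrite -[LHS](_ : #|[set x in [set g] | x \in A]| = _); last first.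
    case: (boolP (g \in A)) => gA.
      by apply/eqP/cards1P; exists g; apply/setP => x; rewrite !inE; case: eqP => // ->.
    by apply/eqP; rewrite cards_eq0; apply/eqP/setP => x; rewrite !inE;
       case: eqP => // ->; apply/negbTE.
  by congr #|pred_of_set _|; apply/setP => x; rewrite !inE subr_eq0 andbC.
rewrite !diff_multE -!sum1_card.
under eq_bigl do rewrite inE.
under [X in (_ + X + _)%N]eq_bigl do rewrite inE.
under [X in (_ + _ + X)%N]eq_bigl do rewrite inE.
rewrite !big_mkcondr -!big_split /=; apply: eq_bigr => x _.
rewrite mem_blockC; case: eqP => [->|_]; first by rewrite (negbTE zero_notin_block).
by case: (_ \in A).
Qed.

Lemma diff_mult_block0 : diff_mult A B 0 = 0%N.
Proof.
rewrite diff_multE; apply/eqP; rewrite cards_eq0; apply/eqP/setP => x.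
by rewrite !inE subr0; case: (boolP (x \in A)) => // /(disjointFr AB_disj).
Qed.

Lemma block_opp_closed (l : nat) :
  (forall g, g != 0 -> diff_mult A B g = l) -> A = [set - x | x in A].
Proof.
move=> ABl.
have memN x : (- x \in A) = (x \in A).
  have [->|x0] := eqVneq x 0; first by rewrite oppr0.
  (* Between the identities at [x] and [- x] the first two terms agree, so the indicators must agree
     too. *)
  have := diff_mult_partition (- x); have := diff_mult_partition x.
  rewrite diff_multN !ABl ?oppr_eq0 //.
  by case: (x \in A); case: (- x \in A) => //=; lia.
apply/setP => x; apply/idP/imsetP => [xA|[y yA ->]]; last by rewrite memN.
by exists (- x); rewrite ?opprK ?memN.
Qed.

Lemma card_of_constant_diff_mult (l : nat) : #|A| = #|B| -> (0 < #|A|)%N ->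
  (forall g, g != 0 -> diff_mult A B g = l) -> #|A| = (2 * l)%N.
Proof.
move=> cAB A_gt0 ABl; have := sum_diff_mult A B.
(* Disjointness kills the term at [0]; each of the other [#|G|.-1 = 2 * #|A|] terms equals [l].
   Cancelling [#|A|] then needs [A] nonempty. *)
rewrite (bigD1 (0 : G)) //= diff_mult_block0 add0n.
rewrite (eq_bigr (fun=> l)); last by move=> g /ABl.
rewrite sum_nat_const (_ : #|_| = #|G|.-1); last first.
  by rewrite -(cardsC1 (0 : G)); apply: eq_card => g; rewrite !inE.
rewrite -card_block_partition -cAB => e.
by apply/eqP; rewrite -(eqn_pmul2l A_gt0) -e; apply/eqP; lia.
Qed.

Lemma Paley_of_constant_diff_mult (l : nat) : #|A| = #|B| ->
  (forall g, g != 0 -> diff_mult A B g = l) -> is_Paley_PDS #|G| A.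
Proof.
move=> cAB ABl.
have G_gt0 : (0 < #|G|)%N by apply/card_gt0P; exists 0.
have cG := card_block_partition.
(* If [A] is empty then [G] is trivial: both multiplicity conditions hold vacuously, although [l] is
   then arbitrary. *)
have [A0|A_gt0] := posnP #|A|.
  have G1 : #|G| = 1%N by lia.
  have zeroE (g : G) : g == 0 by apply/eqP/(fintype_le1P _); rewrite ?G1.
  rewrite /is_Paley_PDS; split; first by rewrite G1.
  split; [|exact: zero_notin_block|exact: block_opp_closed ABl].
  by split; rewrite ?A0 ?G1 // => g; rewrite zeroE.
have cA := card_of_constant_diff_mult cAB A_gt0 ABl.
have cGl : #|G| = (4 * l + 1)%N by lia.
split; first by rewrite cGl mulnC modnMDl.
split; [|exact: zero_notin_block|exact: block_opp_closed ABl].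
(* As [#|A| = 2 * l], the identity leaves [l - 1 = (v - 5) / 4] on [A] and [l = (v - 1) / 4] off it,
   where [v = 4 * l + 1]. *)
split; [by []|lia| |] => g g0 gA; rewrite self_diff_multE //;
  have := diff_mult_partition g; rewrite ABl //.
  by rewrite gA; lia.
by rewrite (negbTE gA); lia.
Qed.

Lemma constant_diff_mult_of_Paley (g : G) :
  is_Paley_PDS #|G| A -> g != 0 -> diff_mult A B g = ((#|G| - 1) %/ 4)%N.
Proof.
move=> [v4 [[_ cA Nin Nout] _ _]] g0.
have := diff_mult_partition g; rewrite -self_diff_multE //.
have [gA|gA] := boolP (g \in A).
  (* A nonempty [A] excludes [#|G| = 1], hence [#|G|] is at least 5 and the subtraction in
     [(#|G| - 5) %/ 4] is not truncated. *)
  rewrite Nin //; have : (0 < #|A|)%N by apply/card_gt0P; exists g.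
  by lia.
by rewrite Nout //; lia.
Qed.

End Partition.

(** With two blocks each sum has a single term, and the condition for the second block at [g] is the
    one for the first at [- g]. *)
Lemma SEDF_pairP (G : finZmodType) (k l : nat) (A B : {set G}) :
  #|A| = k -> #|B| = k -> [disjoint A & B] ->
  is_SEDF #|G| k l [tuple A; B] <-> forall g, g != 0 -> diff_mult A B g = l.
Proof.
move=> cA cB AB; split=> [[_ _ _ _ H] g g0|H].
  have := H ord0 g g0.
  by rewrite big_mkcond !big_ord_recl big_ord0 /= addn0 add0n.
split=> //.
- by case=> -[|[|//]] i.
- by move=> [[|[|//]] i] [[|[|//]] j] //= _; rewrite // disjoint_sym.
case=> -[|[|//]] i g g0; rewrite big_mkcond !big_ord_recl big_ord0 /= !addn0.
  by rewrite add0n; apply: H.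
by rewrite -diff_multN; apply: H; rewrite oppr_eq0.
Qed.

Theorem theorem4p6 (G : finZmodType) (v : nat) (D1 D2 : {set G})
    (hv : #|G| = v)
    (hD1 : #|D1| = ((v - 1) %/ 2)%N)
    (hD2 : #|D2| = ((v - 1) %/ 2)%N)
    (hdisj : [disjoint D1 & D2])
    (hcover : D1 :|: D2 = [set~ 0]) :
  ((exists lambda : nat, is_SEDF v ((v - 1) %/ 2) lambda [tuple D1; D2])
    <-> is_Paley_PDS v D1)
  /\ (is_Paley_PDS v D1 -> is_Paley_PDS v D2).
Proof.
subst v; have cD : #|D1| = #|D2| by rewrite hD1.
have const12 := constant_diff_mult_of_Paley hdisj hcover.
split; first split=> [[l /(SEDF_pairP l hD1 hD2 hdisj)]|P1].
- exact: Paley_of_constant_diff_mult.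
- exists ((#|G| - 1) %/ 4)%N; apply/SEDF_pairP => // g; exact: const12.
(* Constancy off [0] survives exchanging the blocks, since this only replaces [g] by [- g]; so the
   argument for [D1] applies to [D2]. *)
move=> P1; have hdisj' : [disjoint D2 & D1] by rewrite disjoint_sym.
apply: (Paley_of_constant_diff_mult hdisj' _ (esym cD)); first by rewrite setUC.
by move=> g g0; rewrite -diff_multN; apply: const12; rewrite ?oppr_eq0.
Qed.
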